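(* Let $p$ be a prime, let $J\ge 1$ be an integer, and let $H,K>0$. For $1\le j\le J$ let $I_1^{(j)},I_2^{(j)}\subseteq(0,p)$ be closed intervals with $|I_1^{(j)}|=H$ and $|I_2^{(j)}|=K$, where $I_1^{(j)}$ is centered at an integer $M_j$ and $I_2^{(j)}$ is centered at an integer $N_j$. (The intervals $I_1^{(j)}$ are not required to be pairwise disjoint.) Suppose that for some $X\ge 1$ the integers $M_j$ are $X$-spaced modulo $p$, i.e. $$p\cdot\left\|\frac{M_j-M_k}{p}\right\|\ge X\quad\text{for all } j\neq k,$$ where $\|z\|$ denotes the distance from the real number $z$ to the nearest integer. Then for every $\varepsilon>0$ there is a constant $C_\varepsilon>0$ such that, if $$J\ge C_\varepsilon\,\frac{p^3(\log p)^{3+\varepsilon}}{HK^2\min\{H,X\}},$$ there exists $j\in\{1,\dots,J\}$ and integers $x\in I_1^{(j)}$, $y\in I_2^{(j)}$ with $xy\equiv 1\pmod p$.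
   Context: $|I|$ denotes the length of an interval $I$. *)

(* Defs.v *)
From mathcomp Require Import all_boot all_order all_algebra.
From mathcomp Require Import all_classical all_reals all_analysis.
Set Implicit Arguments.
Unset Strict Implicit.
Unset Printing Implicit Defensive.
Import Order.TTheory GRing.Theory Num.Theory.
Local Open Scope classical_set_scope.
Local Open Scope ring_scope.

(* The bound [a <= b] excludes degenerate presentations of
   the empty set, so that the length and the centre are determined by I. *)
Definition closed_interval_centered {R : realType} (I : set R) (c L : R) : Prop :=
  exists a b : R, [/\ a <= b, I = `[a, b]%classic, b - a = L & (a + b) / 2 = c].

Definition dist_nearest_int {R : realType} (z : R) : R :=
  inf [set `|z - n%:~R| | n in [set: int]].

(* Main.v *)
Require Import Defs.
From mathcomp Require Import all_classical all_reals all_analysis.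
From mathcomp Require Import all_boot all_order all_algebra all_field.
From mathcomp Require Import ring lra zify.
Set Implicit Arguments.
Unset Strict Implicit.
Unset Printing Implicit Defensive.
Import Order.TTheory GRing.Theory Num.Theory.
Local Open Scope ring_scope.

(** Let [h], [k] be the numbers of integers in half of each interval and detect a solution
    in the box with centre [(M_j, N_j)] by the Fejer weights [1_A * 1_(-A)] with [A = {0,
    ..., h - 1}], whose Fourier coefficients are squared absolute values. Summing over
    [j], the frequency [(0, 0)] contributes about [J h^2 k^2 / p]. The other frequencies
    are bounded by Weil's bound [|Kl (a, b)|^2 <= 4 p], Cauchy-Schwarz and Parseval; the
    spacing of the [M_j] limits the number of pairs [(j, l)] surviving in Parseval. If
    there is no solution the two contributions cancel, which forces [J <= 768 p^3 / (H K^2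
    min (H, X))].

    Weil's bound is proved by passing to fields [F_q] with [q = p^(2^k)]. Pairing the
    roots of all quadratics over [F_q] gives [Kl_(q^2) = 2 q - Kl_q^2], so a sum with
    [Kl_p^2 > 4 p] would make [Kl_q^2 / q] unbounded along the tower. On the other hand
    [Kl_q <= 2 sqrt q] for [k >= 1], so it is enough to bound from below the sum over [c]
    in [F_p] of [Kl_q (c, c b)]. This sum is at least the number of points of [y^p - y = x
    + b / x] over [F_q], that is, of [z^2 = (y^p - y)^2 - 4 b], and Stepanov's method
    bounds the number of [y] for which the right-hand side is not a square. *)

(** * Quadratic extensions of finite fields *)

(** Swapping the coordinates of a pair keeps its sum and product, so (sum, product) is not injective
    on the finite set [F * F], hence not onto. A missed [(s, n)] gives a quadratic [X^2 - s X + n]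
    without roots in [F]. *)
Lemma quadratic_extension (F : finFieldType) :
  exists E : finFieldType, exists iota : {rmorphism F -> E},
    #|E| = (#|F| ^ 2)%N.
Proof.
pose sp (u : F * F) := (u.1 + u.2, u.1 * u.2).
have [[s n] Hsn] : exists sn : F * F, forall u, sp u != sn.
  suff /forallPn [sn /existsPn Hsn] : ~~ [forall sn, [exists u, sp u == sn]].
    by exists sn.
  apply/negP => /forallP surj.
  have /imset_injP inj : #|sp @: [set: F * F]| == #|[set: F * F]|.
    rewrite -(_ : [set: F * F] = sp @: [set: F * F]) //; apply/setP => sn; rewrite inE.
    have /existsP[u /eqP <-] := surj sn.
    by rewrite imset_f.
  have /eqP : ((0, 1) : F * F) = (1, 0).
    by apply: inj; rewrite ?inE // /sp /= addrC mulrC.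
  by rewrite xpair_eqE eq_sym oner_eq0.
pose h : {poly F} := 'X^2 - s *: 'X + n%:P.
have szs : (size (- (s *: 'X) + n%:P)%R < 3)%N.
  apply: leq_ltn_trans (size_polyD _ _) _; rewrite gtn_max size_polyN.
  by rewrite (leq_ltn_trans (size_scale_leq _ _)) ?size_polyX //
       (leq_ltn_trans (size_polyC_leq1 _)).
have szh : size h = 3.
  by rewrite /h -addrA size_polyDl size_polyXn.
have hm : h \is monic.
  by rewrite monicE /h -addrA lead_coefDl ?lead_coefXn // size_polyXn.
have hirr : irreducible_poly h.
  apply: cubic_irreducible; first by rewrite szh.
  move=> x; apply/negP => /rootP; rewrite /h !hornerE => hx.
  have := Hsn (x, s - x); rewrite /sp /= => /eqP; apply.
  congr pair; first by rewrite addrC subrK.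
  by rewrite -[RHS](subr0) -hx; ring.
have hI : monic_irreducible_poly h by split.
exists {poly %/ h with hI}, (in_alg {poly %/ h with hI}).
by rewrite card_qfpoly szh.
Qed.

Lemma card_finField_pchar (F : finFieldType) p :
  p \in [pchar F] -> {n | #|F| = (p ^ n)%N}.
Proof.
move=> pF; pose R := pPrimeCharType pF.
exists (logn p #|R|); rewrite -(card_pprimeChar pF).
by apply: (@bij_eq_card F R id); exists id.
Qed.

(** * Frobenius, trace and norm of a quadratic extension *)

Section QuadraticExtension.

Variables (F E : finFieldType) (iota : {rmorphism F -> E}).
Hypothesis cardFE : #|E| = (#|F| ^ 2)%N.
Let q := #|F|.

Lemma frob_fixed (x : F) : iota x ^+ q = iota x.
Proof. by rewrite -rmorphXn expf_card. Qed.

(** The image of [F] already supplies the at most [q] roots of [X^q - X]. *)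
Lemma fixed_frob (z : E) : z ^+ q = z -> exists x, iota x = z.
Proof.
move=> zq; have [x /eqP ->|nx] := pickP (fun x => z == iota x); first by exists x.
exfalso; have q1 : (1 < q)%N := finNzRing_gt1 F.
pose P : {poly E} := 'X^q - 'X.
have szP : size P = q.+1.
  by rewrite /P size_polyDl ?size_polyXn // size_polyN size_polyX ltnS.
have P0 : P != 0 by rewrite -size_poly_eq0 szP.
have /(_ (z :: map iota (enum F))) := max_poly_roots P0.
rewrite szP /= size_map -cardE ltnn -/q => H.
have : false.
  apply: H.
    rewrite /root /P !hornerE zq subrr eqxx /=; apply/allP => _ /mapP[x _ ->].
    by rewrite /root !hornerE frob_fixed subrr.
  rewrite map_inj_uniq ?enum_uniq ?andbT; last exact: fmorph_inj.
  by apply/mapP => -[x _ e]; have := nx x; rewrite e eqxx.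
by [].
Qed.

Lemma frobD (x y : E) : (x + y) ^+ q = x ^+ q + y ^+ q.
Proof.
have [p _ pF] := finPcharP F; have [n qpn] := card_finField_pchar pF.
apply: exprDn_pchar.
rewrite /q qpn pnatX orbC (eq_pnat _ (pcharf_eq (rmorph_pchar iota pF))).
by rewrite pnat_id ?orbT // (pcharf_prime pF).
Qed.

Lemma frobK (x : E) : x ^+ q ^+ q = x.
Proof. by rewrite -exprM mulnn -cardFE expf_card. Qed.

(** The default 0 is never reached when [E] has [q ^ 2] elements: [z + z ^+ q] and [z * z ^+ q] are
    then fixed by Frobenius, so they come from [F]. *)
Definition qtrace (z : E) : F := odflt 0 [pick x | iota x == z + z ^+ q].
Definition qnorm (z : E) : F := odflt 0 [pick x | iota x == z * z ^+ q].

Lemma qtraceE z : iota (qtrace z) = z + z ^+ q.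
Proof.
rewrite /qtrace; case: pickP => [x /eqP //|]; have [] := @fixed_frob (z + z ^+ q).
  by rewrite frobD frobK addrC.
by move=> x <- /(_ x); rewrite eqxx.
Qed.

Lemma qnormE z : iota (qnorm z) = z * z ^+ q.
Proof.
rewrite /qnorm; case: pickP => [x /eqP //|]; have [] := @fixed_frob (z * z ^+ q).
  by rewrite exprMn frobK mulrC.
by move=> x <- /(_ x); rewrite eqxx.
Qed.

Definition sum_prod (u : F * F) := (u.1 + u.2, u.1 * u.2).
Definition trace_norm (z : E) := (qtrace z, qnorm z).

Lemma sum_prod_fiber x y : 
  [set u | sum_prod u == sum_prod (x, y)] \subset [set (x, y); (y, x)].
Proof.
apply/subsetP => -[v w]; rewrite !inE !xpair_eqE /= => /andP[/eqP s /eqP n].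
have /eqP : (v - x) * (v - y) = 0.
  have -> : (v - x) * (v - y) = v * v - v * (x + y) + x * y by ring.
  by rewrite -s -n; ring.
rewrite mulf_eq0 !subr_eq0 => /orP[] /eqP e; subst v; rewrite eqxx /=.
  by move/addrI: s => ->; rewrite eqxx.
by rewrite orbC; move: s; rewrite addrC => /addIr ->; rewrite eqxx.
Qed.

Lemma trace_norm_root z w :
  iota (qtrace w) = iota (qtrace z) -> iota (qnorm w) = iota (qnorm z) ->
  (w == z) || (w == z ^+ q).
Proof.
rewrite !qtraceE !qnormE => s n; rewrite -!(subr_eq0 w) -mulf_eq0.
have -> : (w - z) * (w - z ^+ q) = w * w - w * (z + z ^+ q) + z * z ^+ q by ring.
by rewrite -s -n; apply/eqP; ring.
Qed.

(** Both sets come from the roots of [X^2 - s X + n]. Distinct roots in [F] give two ordered pairs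
    and no [z], a double root gives one of each, and without roots in [F] only a conjugate pair [z],
    [z ^+ q] remains. *)
Lemma fiber_le2 sn :
  (#|[set u | sum_prod u == sn]| + #|[set z | trace_norm z == sn]| <= 2)%N.
Proof.
have [u|nou] := pickP [pred u | sum_prod u == sn]; last first.
  rewrite (_ : [set u | _] = set0) ?cards0; last first.
    by apply/setP => u; rewrite !inE; exact: nou.
  have [z /= /eqP zsn|noz] := pickP [pred z | trace_norm z == sn]; last first.
    by rewrite (_ : [set u | _] = set0) ?cards0 //; apply/setP => u; rewrite !inE; exact: noz.
  rewrite add0n -zsn; apply: (@leq_trans #|[set z; z ^+ q]|); last first.
    by rewrite cards2 ltnS leq_b1.
  apply/subset_leq_card/subsetP => w; rewrite !inE xpair_eqE => /andP[/eqP s /eqP n].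
  by apply: trace_norm_root; rewrite ?s ?n.
case: u => x y /= /eqP <-.
(* Such a [z] is a root of [(X - x) (X - y)], hence fixed by Frobenius; its trace is then [2 z],
   which makes the two roots equal. *)
have inE z : trace_norm z == sum_prod (x, y) -> z = iota x /\ x = y.
  rewrite xpair_eqE => /andP[/eqP s /eqP n].
  have sE : z + z ^+ q = iota x + iota y by rewrite -qtraceE s rmorphD.
  have nE : z * z ^+ q = iota x * iota y by rewrite -qnormE n rmorphM.
  have /eqP : (z - iota x) * (z - iota y) = 0.
    have -> : (z - iota x) * (z - iota y) =
        z * z - z * (iota x + iota y) + iota x * iota y by ring.
    by rewrite -sE -nE; ring.
  rewrite mulf_eq0 !subr_eq0 => /orP[] /eqP e; move: sE; rewrite e frob_fixed.
    by move/addrI/fmorph_inj ->.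
  by move/addIr/fmorph_inj ->.
have [exy|nxy] := eqVneq x y.
  apply: (@leq_trans (1 + 1)) => //; apply: leq_add.
    apply: leq_trans (subset_leq_card (sum_prod_fiber x y)) _.
    by rewrite exy setUid cards1.
  rewrite -(cards1 (iota x)); apply/subset_leq_card/subsetP => z.
  by rewrite in_set => /inE[-> _]; rewrite set11.
rewrite [X in (_ + #|pred_of_set X|)%N](_ : _ = set0); last first.
  apply/setP => z; rewrite in_set in_set0; apply/negP => /inE[_ e].
  by rewrite e eqxx in nxy.
rewrite cards0 addn0; apply: leq_trans (subset_leq_card (sum_prod_fiber x y)) _.
by rewrite cards2 ltnS leq_b1.
Qed.

Lemma card_partition (T S : finType) (f : T -> S) :
  (\sum_s #|[set t | f t == s]| = #|T|)%N.
Proof.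
under eq_bigr do rewrite cardsE -sum1_card.
by rewrite -sum1_card [RHS](partition_big f predT).
Qed.

(* The fibres have total size [2 q ^ 2] over [q ^ 2] points. *)
Lemma fiber_eq2 sn :
  (#|[set u | sum_prod u == sn]| + #|[set z | trace_norm z == sn]| = 2)%N.
Proof.
apply/eqP; rewrite eqn_leq fiber_le2 /= leqNgt; apply/negP => lt2.
suff : (\sum_sn (#|[set u | sum_prod u == sn]| + #|[set z | trace_norm z == sn]|)
   < \sum_(sn : F * F) 2)%N.
  rewrite big_split /= !card_partition sum_nat_const card_prod cardFE.
  by rewrite expnS expn1 muln2 addnn ltnn.
rewrite (bigD1 sn) //= [X in (_ < X)%N](bigD1 sn) //= -addSn.
by apply: leq_add => //; apply: leq_sum => ? _; exact: fiber_le2.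
Qed.

End QuadraticExtension.

(** * Kloosterman sums in a quadratic extension *)

Definition additive_character (F : finFieldType) (psi : F -> algC) :=
  psi 0 = 1 /\ {morph psi : x y / x + y >-> x * y}.

Definition kloosterman (F : finFieldType) (psi : F -> algC) (a b : F) : algC :=
  \sum_(x | x != 0) psi (a * x + b / x).

Section AdditiveCharacter.

Variables (F : finFieldType) (psi : F -> algC).
Hypothesis psi_char : additive_character psi.

Lemma char0 : psi 0 = 1. Proof. by case: psi_char. Qed.
Lemma charD x y : psi (x + y) = psi x * psi y. Proof. by case: psi_char => _ ->. Qed.

Lemma charMn x n : psi (x *+ n) = psi x ^+ n.
Proof.
elim: n => [|n IHn]; first by rewrite mulr0n char0 expr0.
by rewrite mulrS exprS charD IHn.
Qed.

Lemma char_neq0 x : psi x != 0.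
Proof.
apply/eqP => x0; have := char0; rewrite -(subrr x) charD x0 mul0r => /eqP.
by rewrite eq_sym oner_eq0.
Qed.

Lemma norm_char x : `|psi x| = 1.
Proof.
have [p p_pr pF] := finPcharP F.
apply/eqP; rewrite -(@pexpr_eq1 _ _ p) ?prime_gt0 // -normrX -charMn.
by rewrite -mulr_natr pcharf0 // mulr0 char0 normr1.
Qed.

Lemma charN x : psi (- x) = (psi x)^*.
Proof.
apply: (mulfI (char_neq0 x)); rewrite -charD subrr char0 -normCK norm_char.
by rewrite expr1n.
Qed.

Lemma sum_char (x0 : F) : psi x0 != 1 -> \sum_x psi x = 0.
Proof.
move=> x01; apply/eqP; have : (psi x0 - 1) * \sum_x psi x = 0.
  rewrite mulrBl mul1r [X in _ - X](reindex_inj (addrI x0)) /= mulr_sumr.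
  by apply/eqP; rewrite subr_eq0; apply/eqP/eq_bigr => x _; rewrite charD.
by move/eqP; rewrite mulf_eq0 subr_eq0 (negPf x01).
Qed.

Lemma sum_charM (x0 : F) a :
  psi x0 != 1 -> \sum_x psi (x * a) = if a == 0 then #|F|%:R else 0.
Proof.
move=> x01; case: eqVneq => [->|a0].
  by rewrite (eq_bigr (fun=> 1)) ?sumr_const // => x _; rewrite mulr0 char0.
by have := sum_char x01; rewrite (reindex_inj (mulIf a0)).
Qed.

Lemma kloosterman_real a b : kloosterman psi a b \is Num.real.
Proof.
apply/CrealP; rewrite /kloosterman rmorph_sum /= [RHS](reindex_inj oppr_inj) /=.
apply: eq_big => x; first by rewrite oppr_eq0.
by move=> _; rewrite -charN invrN !mulrN -opprD.
Qed.

Lemma kloosterman_scale a b : a != 0 -> kloosterman psi a b = kloosterman psi 1 (a * b).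
Proof.
move=> a0; have ia0 : a^-1 != 0 by rewrite invr_eq0.
rewrite /kloosterman (reindex_inj (mulfI ia0)) /=.
apply: eq_big => x; first by rewrite mulf_eq0 negb_or ia0.
by move=> x0; rewrite invfM invrK mulrA mulfV // mul1r [b * _]mulrA [b * a]mulrC.
Qed.

End AdditiveCharacter.

(** * Characters lifted by the trace, and the recursion for Kloosterman sums *)

Section KloostermanQuadratic.

Variables (F E : finFieldType) (iota : {rmorphism F -> E}).
Hypothesis cardFE : #|E| = (#|F| ^ 2)%N.
Variable psi : F -> algC.
Hypothesis psi_char : additive_character psi.
Let q := #|F|.

Let psiE := psi \o (qtrace iota).
Local Notation tr := (qtrace iota).

Lemma qtraceD : {morph tr : x y / x + y}.
Proof.
move=> x y; apply: (fmorph_inj iota); rewrite rmorphD !(qtraceE iota cardFE).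
by rewrite (frobD iota); ring.
Qed.

Lemma qtraceZ a x : tr (iota a * x) = a * tr x.
Proof.
apply: (fmorph_inj iota); rewrite rmorphM !(qtraceE iota cardFE).
by rewrite exprMn (frob_fixed iota); ring.
Qed.

Lemma additive_character_qtrace : additive_character psiE.
Proof.
split=> [|x y]; rewrite /psiE /= ?qtraceD ?(charD psi_char) //.
by have := qtraceZ 0 0; rewrite rmorph0 !mul0r => ->; exact: char0.
Qed.

Lemma qtrace_pchar p x : p \in [pchar F] -> tr (x ^+ p) = tr x ^+ p.
Proof.
move=> pF; apply: (fmorph_inj iota); rewrite rmorphXn !(qtraceE iota cardFE).
have pE := rmorph_pchar iota pF.
by rewrite exprAC; exact: (esym (rmorphD (pFrobenius_aut pE) _ _)).
Qed.

Lemma qnorm_eq0 z : (qnorm iota z == 0) = (z == 0).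
Proof.
rewrite -(fmorph_eq0 iota) (qnormE iota cardFE) mulf_eq0 expf_eq0.
by rewrite (ltnW (finNzRing_gt1 F)) orbb.
Qed.

Lemma qtraceV z : z != 0 -> tr z^-1 = tr z / qnorm iota z.
Proof.
move=> z0; have zq0 : z ^+ q != 0 by rewrite expf_eq0 (negPf z0) andbF.
apply: (fmorph_inj iota).
rewrite rmorphM fmorphV /= !(qtraceE iota cardFE) (qnormE iota cardFE) exprVn.
by field; rewrite zq0 z0.
Qed.

(* The unordered pairs of [F] and the conjugate pairs of [E] together are the roots of all
   the quadratics [X^2 - s X + n], each counted twice. *)
Lemma kloosterman_quadratic (a b x0 : F) : psi x0 != 1 -> a != 0 -> b != 0 ->
  kloosterman psiE (iota a) (iota b) = q%:R *+ 2 - kloosterman psi a b ^+ 2.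
Proof.
move=> x01 a0 b0; apply/eqP; rewrite eq_sym subr_eq eq_sym; apply/eqP.
(* The common summand: [x + y = s] and [1 / x + 1 / y = s / n] for a pair with sum [s] and product
   [n], and likewise for the pair [z], [z ^+ q]. *)
pose f (sn : F * F) := psi (a * sn.1 + b * (sn.1 / sn.2)).
have -> : kloosterman psi a b ^+ 2 =
    \sum_(sn : F * F | sn.2 != 0) \sum_(u | sum_prod u == sn) f sn.
  rewrite /kloosterman expr2 big_distrlr pair_big /=.
  rewrite (partition_big (@sum_prod F) (fun sn => sn.2 != 0)) /=; last first.
    by move=> [x y]; rewrite /= mulf_eq0 negb_or.
  apply: eq_bigr => sn sn2; apply: eq_big => [[x y]|[x y]] /=.
    apply: andb_idl => /eqP e; move: sn2.
    by rewrite -e /= mulf_eq0 negb_or.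
  rewrite -(charD psi_char) => /andP[/andP[x0' y0'] /eqP <-]; congr psi => /=.
  by field; rewrite x0' y0'.
have -> : kloosterman psiE (iota a) (iota b) =
    \sum_(sn : F * F | sn.2 != 0) \sum_(z | trace_norm iota z == sn) f sn.
  rewrite /kloosterman.
  rewrite (partition_big (trace_norm iota) (fun sn => sn.2 != 0)) /=; last first.
    by move=> z; rewrite /= qnorm_eq0.
  apply: eq_bigr => sn sn2; apply: eq_big => [z|z] /=.
    by rewrite -(qnorm_eq0 z); apply: andb_idl => /eqP e; move: sn2; rewrite -e.
  move=> /andP[z0 /eqP <-]; rewrite /psiE /= qtraceD !qtraceZ qtraceV //.
rewrite -big_split /=.
rewrite (eq_bigr (fun sn => f sn *+ 2)) => [|sn _]; last first.
  rewrite !sumr_const -mulrnDr -(fiber_eq2 iota cardFE sn) addnC.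
  by congr (_ *+ (_ + _)); apply: eq_card => u; rewrite inE.
rewrite sumrMnl; congr (_ *+ 2).
rewrite -(pair_big predT (fun n : F => n != 0) (fun s n => f (s, n))) /=.
rewrite exchange_big /=.
have n00 : - b / a != 0 by rewrite mulf_neq0 ?oppr_eq0 ?invr_eq0.
(* For fixed [n] the sum over [s] is a complete character sum, which survives only when
   [a + b / n = 0]. *)
rewrite (eq_bigr (fun n => if n == - b / a then q%:R else 0)) => [|n n0]; last first.
  transitivity (\sum_s psi (s * (a + b / n))).
    by apply: eq_bigr => s _; rewrite /f /=; congr psi; field.
  rewrite (sum_charM psi_char _ x01); congr (if _ then _ else _).
  apply/eqP/eqP => [e|->]; last by field; rewrite ?oppr_eq0 ?a0 ?b0.
  apply: (mulfI a0); transitivity (- b + n * (a + b / n)); first by field.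
  by rewrite e; field.
rewrite -big_mkcondr (big_pred1 (- b / a)) // => n /=.
by case: (eqVneq n (- b / a)) => [->|]; rewrite ?andbF ?n00.
Qed.

End KloostermanQuadratic.

(** * Stepanov's method *)

Section PolynomialLemmas.

Variable F : fieldType.
Implicit Types (D a b : {poly F}) (P : {poly {poly F}}).

(** The cofactor [U] of [gcdp D a] in [D] is coprime to [a] by separability, yet divides [a ^+ 2];
    so it is a unit. *)
Lemma separable_dvdp_sqr D a : separable_poly D -> (D %| a ^+ 2) = (D %| a).
Proof.
move=> sepD; apply/idP/idP => [Da2|/dvdp_trans]; last by apply; rewrite dvdp_exp.
have D0 : D != 0 by exact: separable_poly_neq0.
pose G := gcdp D a; pose U := D %/ G.
have DE : D = U * G by rewrite /U divpK // dvdp_gcdl.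
have cUG : coprimep U G by move: sepD; rewrite DE separable_mul => /and3P[].
have cUa : coprimep U a.
  rewrite /coprimep -dvdp1 -(eqp_dvdr _ (_ : gcdp U G %= 1)); last first.
    by rewrite -size_poly_eq1.
  rewrite dvdp_gcd dvdp_gcdl /= dvdp_gcd dvdp_gcdr andbT DE.
  by rewrite dvdp_mulr // dvdp_gcdl.
have : U %| a ^+ 2 by apply: dvdp_trans Da2; rewrite DE dvdp_mulr.
rewrite -[a ^+ 2]mulr1 Gauss_dvdpr ?coprimep_expr // dvdp1 => /size_poly1P[c c0 Uc].
by rewrite DE Uc mul_polyC dvdpZl // dvdp_gcdr.
Qed.

(** Infinite descent: [D] divides [a], then [b], and the quotients satisfy the same equation. *)
Lemma separable_not_square_ratio D a b :
  separable_poly D -> (1 < size D)%N -> a ^+ 2 = D * b ^+ 2 -> b = 0.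
Proof.
move=> sepD szD; have D0 : D != 0 by exact: separable_poly_neq0.
have [n] := ubnP (size b); elim: n a b => // n IHn a b szb abD.
have /dvdpP[a' a'E] : D %| a by rewrite -separable_dvdp_sqr // abD dvdp_mulr.
have bE : b ^+ 2 = D * a' ^+ 2.
  by apply: (mulfI D0); rewrite -abD a'E exprMn; ring.
have /dvdpP[b' b'E] : D %| b by rewrite -separable_dvdp_sqr // bE dvdp_mulr.
apply/eqP/negPn/negP => b0; have b'0 : b' != 0.
  by apply: contraNneq b0 => b'0; rewrite b'E b'0 mul0r.
move/eqP: (b'0); apply; apply: (IHn a').
  have szb' : (0 < size b')%N by rewrite size_poly_gt0.
  move: szb szb' szD; rewrite b'E size_mul //.
  move: (size (b' : {poly F})) (size D) => u v; lia.
by apply: (mulfI D0); rewrite -bE b'E exprMn; ring.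
Qed.

(** Coefficients of degree below [Q] are the digits of an expansion in base ['X^Q], so they can be
    read off. *)
Lemma horner_Xn_inj P Q :
  (0 < Q)%N -> (forall i, size (P`_i)%R <= Q)%N -> P.['X^Q] = 0 -> P = 0.
Proof.
move=> Q0; elim/poly_ind: P => // P c IHP szP.
have szc : (size c <= Q)%N.
  by have := szP 0%N; rewrite coefD coefMX coefC /= add0r.
rewrite hornerD hornerMX hornerC => /eqP; rewrite addr_eq0 => /eqP e.
have P0 : P.['X^Q] = 0.
  apply/eqP/negPn/negP => P0; move/(congr1 (fun p : {poly F} => size p)): e.
  rewrite size_polyN size_mulXn // => e; move: szc; rewrite -e.
  by rewrite leqNgt -[X in (X < _)%N]addn0 ltn_add2l size_poly_gt0 P0.
have -> : P = 0.
  by apply: IHP => // i; have := szP i.+1; rewrite coefD coefMX coefC /= addr0.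
move: e; rewrite P0 mul0r => /eqP; rewrite eq_sym oppr_eq0 => /eqP ->.
by rewrite mul0r addr0.
Qed.

Lemma size_coef_mul (P1 P2 : {poly {poly F}}) s t :
  (forall i, size (P1`_i)%R <= s)%N -> (forall i, size (P2`_i)%R <= t)%N ->
  forall i, (size ((P1 * P2)`_i)%R <= (s + t).-1)%N.
Proof.
move=> h1 h2 i; rewrite coefM; apply: leq_trans (size_sum _ _ _) _.
apply/bigmax_leqP => j _; apply: leq_trans (size_polyMleq _ _) _.
by rewrite -!subn1 leq_sub2r // leq_add.
Qed.

Lemma dependent_poly (I : finType) (f : I -> {poly F}) n :
  (forall i, size (f i) <= n)%N -> (n < #|I|)%N ->
  exists2 d : I -> F, exists i, d i != 0 & \sum_i d i *: f i = 0.
Proof.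
move=> szf nI.
pose M : 'M[F]_(#|I|, n) := \matrix_i poly_rV (f (enum_val i)).
have kM : kermx M != 0.
  by rewrite kermx_eq0 -row_leq_rank -ltnNge (leq_ltn_trans (rank_leq_col M)).
pose v := nz_row (kermx M).
have v0 : v != 0 by rewrite nz_row_eq0.
have vM : v *m M = 0 by apply/sub_kermxP; exact: nz_row_sub.
exists (fun i => v 0 (enum_rank i)).
  by have /rV0Pn[i vi] := v0; exists (enum_val i); rewrite enum_valK.
rewrite -[RHS](linear0 (@rVpoly F n)) -vM mulmx_sum_row linear_sum /=.
rewrite (reindex (fun j : 'I_#|I| => enum_val j)) /=; last first.
  by exists enum_rank => i _; rewrite ?enum_valK ?enum_rankK.
by apply: eq_bigr => i _; rewrite linearZ rowK /= poly_rV_K // enum_valK.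
Qed.

End PolynomialLemmas.

Lemma horner_rVpoly (R : nzRingType) n (v : 'rV[R]_n) x :
  (rVpoly v).[x] = \sum_i v 0 i * x ^+ i.
Proof.
by rewrite /rVpoly horner_poly; apply: eq_bigr => i _; rewrite valK.
Qed.

(** * The auxiliary polynomial for the discriminant [(X^p - X)^2 - c] *)

Section Stepanov.

Variables (F : finFieldType) (p m h : nat) (c : F).
Let Q := (p ^ m)%N.
Hypothesis pF : p \in [pchar F].
Hypothesis Qh : Q.+1 = (h * 2)%N.
Hypothesis ph : (p < h)%N.
Hypothesis cardF : #|F| = (Q ^ 2)%N.
Hypothesis c0 : c != 0.
Hypothesis cp : c ^+ p = c.

Let p_pr : prime p := pcharf_prime pF.
Let p_gt1 : (1 < p)%N := prime_gt1 p_pr.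

Definition stepanov_disc : {poly F} := ('X^p - 'X) ^+ 2 - c%:P.
Local Notation D := stepanov_disc.

Let g : {poly F} := 'X^p - 'X.

Let size_g : size g = p.+1.
Proof. by rewrite size_polyDl size_polyXn // size_polyN size_polyX. Qed.

Let monic_g : g \is monic.
Proof.
by rewrite monicE lead_coefDl ?lead_coefXn // size_polyXn size_polyN size_polyX.
Qed.

Let size_g2 : size (g ^+ 2) = (2 * p).+1.
Proof. by rewrite expr2 size_monicM ?monic_neq0 // size_g addnS /= addSn addnn mul2n. Qed.

Let size_cP : (size (- c%:P : {poly F}) < size (g ^+ 2)%R)%N.
Proof. by rewrite size_g2 size_polyN size_polyC c0 /= ltnS muln_gt0 (prime_gt0 p_pr). Qed.

Lemma size_disc : size D = (2 * p).+1.
Proof. by rewrite /D -/g size_polyDl. Qed.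

Lemma monic_disc : D \is monic.
Proof.
rewrite monicE /D -/g lead_coefDl //.
by have := monic_exp 2 monic_g; rewrite monicE.
Qed.

(** Since [g] has derivative -1, that of [D] is [-2 g], and [D = g^2 - c] is a nonzero constant
    modulo [g]. *)
Lemma separable_disc : (2%:R : F) != 0 -> separable_poly D.
Proof.
move=> two0.
have dg : g^`() = -1.
  by rewrite derivB derivX derivXn -mulr_natr -polyC_natr (pcharf0 pF) mulr0 sub0r.
have dD : D^`() = (- 2%:R) *: g.
  rewrite /D -/g derivB derivC subr0 expr2 derivM dg mulrN1 mulN1r -opprD.
  by rewrite scaleNr -mulr2n scaler_nat.
rewrite separable_poly.unlock dD coprimepZr ?oppr_eq0 //.
rewrite /D -/g coprimep_sym /coprimep expr2 -mulrN1.
have -> : g * g + c%:P * -1 = g * g - c%:P by ring.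
rewrite (eqp_size (_ : _ %= gcdp g (- c%:P))); last first.
  exact: gcdp_addl_mul.
by rewrite -/(coprimep _ _) -polyCN -alg_polyC coprimepZr ?oppr_eq0 // coprimep1.
Qed.

Let Q_gt0 : (0 < Q)%N. Proof. by rewrite expn_gt0 prime_gt0. Qed.

Let pcharQ (R : nzSemiRingType) : p \in [pchar R] -> [pchar R].-nat Q.
Proof.
by move=> pR; rewrite /Q pnatX orbC (eq_pnat _ (pcharf_eq pR)) pnat_id ?orbT.
Qed.

Let c_frob : c ^+ Q = c.
Proof. by rewrite /Q; elim: (m) => // n IHn; rewrite expnSr exprM IHn. Qed.

Let pP : p \in [pchar {poly F}] := rmorph_pchar (@polyC F) pF.

Let exprBQ (R : comNzRingType) (x y : R) : p \in [pchar R] ->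
  (x - y) ^+ Q = x ^+ Q - y ^+ Q.
Proof.
by move=> pR; have := exprDn_pchar (x - y) y (pcharQ pR); rewrite subrK => ->; rewrite addrK.
Qed.

Let DY : {poly {poly F}} := ('X^p - 'X) ^+ 2 - c%:P%:P.

Let DY_map : DY = map_poly polyC D.
Proof. by rewrite /DY /D rmorphB rmorphXn rmorphB rmorphXn /= !map_polyX map_polyC. Qed.

Let disc_frob : D ^+ Q = DY.['X^Q].
Proof.
rewrite /DY /D !exprBQ // !hornerE -polyC_exp c_frob; congr (_ - _).
rewrite -exprM mulnC exprM exprBQ //; congr ((_ - _) ^+ 2).
by rewrite exprAC.
Qed.

(** The exponent is [(Q^2 - 1) / 2], so the [y] counted are those where [D] takes a nonsquare value.
    All of them are roots of a nonzero polynomial [r] of controlled degree, built from a linear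
    relation between the [f i]. *)
Lemma stepanov : (2%:R : F) != 0 ->
  (#|[set y : F | D.[y] ^+ (2 * h * h.-1) == (- 1)%R]| <= h + (h + p).-1 * Q)%N.
Proof.
move=> two0.
(* There are [2 h^2] unknowns against the size bound [(h - 1) Q + h + p = 2 h^2 - 2 h + 1 + p]. The
   bounds [h] and [h - p] on [i] make the degrees in the proof of [r != 0] fit below [Q]. *)
pose I : finType := (('I_h * 'I_(h + p)) + ('I_(h - p) * 'I_h))%type.
pose f (i : I) : {poly F} := match i with
  | inl ij => 'X^(ij.1 * Q + ij.2)
  | inr ij => - D ^+ h * 'X^(ij.1 * Q + ij.2) end.
have szDh : (size (D ^+ h)%R <= p * Q.+1 + 1)%N.
  by apply: leq_trans (size_poly_exp_leq _ _) _; rewrite size_disc Qh; lia.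
have [d [i0 di0] sum0] : exists2 d : I -> F, exists i, d i != 0 & \sum_i d i *: f i = 0.
  apply: (@dependent_poly _ _ _ (h.-1 * Q + (h + p))).
    case=> [[i j]|[i j]] /=.
      rewrite size_polyXn; have := ltn_ord i; have := ltn_ord j.
      move: Q_gt0 (i : nat) (j : nat) => Q0 {}i {}j jlt ilt; nia.
    rewrite mulNr size_polyN; apply: leq_trans (size_polyMleq _ _) _.
    rewrite size_polyXn; have := ltn_ord i; have := ltn_ord j.
    move: Q_gt0 (i : nat) (j : nat) szDh => Q0 {}i {}j; move: (size _) => s hs jlt ilt.
    have : (i * Q <= (h - p).-1 * Q)%N by apply: leq_mul => //; lia.
    have : ((h - p).-1 * Q + p * Q = h.-1 * Q)%N by rewrite -mulnDl; congr muln; lia.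
    nia.
  rewrite card_sum !card_prod !card_ord.
  have : (Q = 2 * h - 1)%N by lia.
  move: Q => q ->; nia.
(* In [r] the exponent [i Q + j] becomes [i + j Q] and coefficients are raised to the power [Q]. As
   [x ^+ (Q ^ 2) = x] on [F], the power [r.[y] ^+ Q] restores the original exponents and
   coefficients. *)
pose A : {poly {poly F}} := rVpoly (\row_(j < h + p)
  rVpoly (\row_(i < h) (d (inl (i, j)) ^+ Q))).
pose B : {poly {poly F}} := rVpoly (\row_(j < h)
  rVpoly (\row_(i < h - p) (d (inr (i, j)) ^+ Q))).
pose r := A.['X^Q] + D ^+ h * B.['X^Q].
have szA i : (size (A`_i)%R <= h)%N.
  rewrite coef_rVpoly; case: insub => [j|]; last by rewrite size_poly0.
  by rewrite mxE size_poly.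
have szB i : (size (B`_i)%R <= h - p)%N.
  rewrite coef_rVpoly; case: insub => [j|]; last by rewrite size_poly0.
  by rewrite mxE size_poly.
have r0 : r != 0.
  apply/eqP => r0.
  (* Squaring turns [D ^+ h] into [D ^+ Q.+1], as [2 h = Q + 1]. *)
  have AB : A.['X^Q] ^+ 2 = D * D ^+ Q * B.['X^Q] ^+ 2.
    rewrite -exprS Qh exprM -exprMn; move/eqP: r0; rewrite addr_eq0 => /eqP ->.
    by rewrite sqrrN.
  (* All inner coefficients have size at most [2 h - 1 = Q], so the identity lifts to two
     independent variables. Its leading coefficients in the outer one would make [D] a ratio of
     squares. *)
  have : A ^+ 2 - (D%:P * DY) * B ^+ 2 = 0.
    apply: (@horner_Xn_inj _ _ Q) => // [i|].
      rewrite coefB; apply: leq_trans (size_polyD _ _) _; rewrite size_polyN geq_max.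
      apply/andP; split.
        by apply: leq_trans (size_coef_mul szA szA i) _; lia.
      have szDD k : (size ((D%:P * DY)`_k)%R <= (2 * p).+1)%N.
        rewrite coefCM DY_map coef_map /= mulrC mul_polyC.
        by rewrite (leq_trans (size_scale_leq _ _)) ?size_disc.
      apply: leq_trans (size_coef_mul szDD (size_coef_mul szB szB) i) _; lia.
    by rewrite hornerD horner_exp hornerN hornerM horner_exp hornerM hornerC
               -disc_frob AB subrr.
  move/eqP; rewrite subr_eq0 => /eqP AB2.
  have lDY : lead_coef DY = 1.
    by rewrite DY_map lead_coef_map (eqP monic_disc).
  have lB : lead_coef B = 0.
    apply: (@separable_not_square_ratio _ D (lead_coef A)).
    - exact: separable_disc.
    - by rewrite size_disc; lia.
    - move/(congr1 (@lead_coef {poly F})): AB2.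
      by rewrite lead_coef_exp lead_coefM lead_coef_exp lead_coefM lead_coefC lDY mulr1.
  have B0 : B = 0 by apply/eqP; rewrite -lead_coef_eq0 lB.
  have A0 : A = 0.
    by move/eqP: AB2; rewrite B0 expr0n mulr0 expf_eq0 => /eqP.
  move/eqP: di0; apply; apply/eqP.
  case: i0 => [[i j]|[i j]].
    have := coef_rVpoly_ord (\row_(j < h + p)
      rVpoly (\row_(i < h) (d (inl (i, j)) ^+ Q))) j.
    rewrite -/A A0 coef0 mxE => /(congr1 (fun q : {poly F} => q`_i)).
    by rewrite coef0 coef_rVpoly_ord mxE => /esym/eqP; rewrite expf_eq0 => /andP[].
  have := coef_rVpoly_ord (\row_(j < h)
    rVpoly (\row_(i < h - p) (d (inr (i, j)) ^+ Q))) j.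
  rewrite -/B B0 coef0 mxE => /(congr1 (fun q : {poly F} => q`_i)).
  by rewrite coef0 coef_rVpoly_ord mxE => /esym/eqP; rewrite expf_eq0 => /andP[].
have szH n s (V : 'rV[{poly F}]_n) : (0 < n)%N -> (forall j, size (V 0%R j) <= s)%N ->
    (size (rVpoly V).['X^Q] <= s + n.-1 * Q)%N.
  move=> n0 sV; rewrite horner_rVpoly; apply: leq_trans (size_sum _ _ _) _.
  apply/bigmax_leqP => j _; rewrite -exprM; apply: leq_trans (size_polyMleq _ _) _.
  rewrite size_polyXn addnS /= leq_add //.
  by rewrite mulnC leq_mul2r -ltnS prednK // ltn_ord orbT.
have szr : (size r <= h + (h + p).-1 * Q)%N.
  apply: leq_trans (size_polyD _ _) _; rewrite geq_max; apply/andP; split.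
    by apply: szH => [|j]; rewrite ?mxE ?size_poly //; lia.
  apply: leq_trans (size_polyMleq _ _) _.
  have szHB : (size B.['X^Q] <= (h - p) + h.-1 * Q)%N.
    by apply: szH => [|j]; rewrite ?mxE ?size_poly //; lia.
  move: szHB szDh; move: (size _) (size _) => s1 s2.
  have : ((h + p).-1 * Q = h.-1 * Q + p * Q)%N by rewrite -mulnDl; congr muln; lia.
  by rewrite mulnS; lia.
apply: leq_trans szr; rewrite cardE ltnW //; apply: max_poly_roots => //; last first.
  exact: enum_uniq.
apply/allP => y; rewrite mem_enum inE => /eqP Dy; rewrite /root.
have : r.[y] ^+ Q == 0; last by rewrite expf_eq0 => /andP[].
have pcharFQ := pcharQ pF.
have frob_sum (J : finType) (G : J -> F) : (\sum_j G j) ^+ Q = \sum_j G j ^+ Q.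
  apply: (big_morph (fun x : F => x ^+ Q)) => [x z|]; first exact: exprDn_pchar.
  by rewrite expr0n gtn_eqF.
have frobK (x : F) : x ^+ Q ^+ Q = x by rewrite -exprM mulnn -cardF expf_card.
have evalV n k (G : 'I_k -> 'I_n -> F) :
    (rVpoly (\row_j rVpoly (\row_i (G i j ^+ Q)))).['X^Q].[y] ^+ Q =
    \sum_i \sum_j G i j * y ^+ (i * Q + j).
  rewrite horner_rVpoly horner_sum frob_sum exchange_big /=.
  apply: eq_bigr => j _; rewrite !mxE hornerM horner_rVpoly mulr_suml frob_sum.
  apply: eq_bigr => i _; rewrite mxE -exprM hornerXn !exprMn frobK.
  by rewrite exprD mulrA -exprM; congr (_ * _); rewrite exprM exprAC frobK.
(* This sign is the one put in front of [D ^+ h] in [f], so [r.[y] ^+ Q] is the relation [sum0]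
   evaluated at [y]. *)
have Dh : D.[y] ^+ (h * Q) = - D.[y] ^+ h.
  have -> : (h * Q = 2 * h * h.-1 + h)%N by nia.
  by rewrite exprD Dy mulN1r.
apply/eqP; rewrite /r hornerD hornerM horner_exp exprDn_pchar // exprMn -exprM Dh !evalV.
have := congr1 (fun q : {poly F} => q.[y]) sum0.
rewrite horner0 horner_sum big_sumType /= => e; rewrite -[RHS]e; congr (_ + _).
  rewrite pair_big; apply: eq_bigr => -[i j] _ /=.
  by rewrite hornerZ hornerXn.
rewrite pair_big mulr_sumr; apply: eq_bigr => -[i j] _ /=.
by rewrite hornerZ hornerM hornerN horner_exp hornerXn; ring.
Qed.

End Stepanov.

(** * Weil's bound *)

(** Squaring is at most two-to-one, so the nonzero squares already exhaust the [n] possible roots of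
    [X^n - 1]. *)
Lemma finField_sqrt (F : finFieldType) n (u : F) :
  #|F| = (2 * n).+1 -> u ^+ n = 1 -> exists z, u = z ^+ 2.
Proof.
move=> cardF un.
have n0 : (0 < n)%N by have := finNzRing_gt1 F; rewrite cardF; lia.
have [z /eqP uz|nz] := pickP (fun z => u == z ^+ 2); first by exists z.
exfalso; pose S := [set z ^+ 2 | z : F & z != 0].
have cardS : (n <= #|S|)%N.
  have : (#|[set z : F | z != 0%R]| <= #|S| * 2)%N.
    rewrite -sum1_card (partition_big_imset (fun z : F => z ^+ 2)) /=.
    rewrite -sum_nat_const; apply: leq_sum => _ /imsetP[z _ ->].
    rewrite sum1_card; apply: (@leq_trans #|[set z; - z]|); last by rewrite cards2 ltnS leq_b1.
    apply/subset_leq_card/subsetP => w; rewrite !inE => /andP[_].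
    by rewrite eqf_sqr.
  have := cardsC1 (0 : F); rewrite cardF.
  by rewrite (_ : [set~ 0] = [set z : F | z != 0]); [lia | apply/setP => z; rewrite !inE].
pose P : {poly F} := 'X^n - 1%:P.
have szP : size P = n.+1 by rewrite size_XnsubC.
have P0 : P != 0 by rewrite -size_poly_eq0 szP.
have := max_poly_roots (rs := u :: enum S) P0; rewrite szP /= -cardE => H.
suff : (#|S|.+1 < n.+1)%N by lia.
apply: H.
  rewrite /root !hornerE un subrr eqxx /=; apply/allP => w; rewrite mem_enum.
  case/imsetP => z; rewrite inE => z0 ->; rewrite /root !hornerE -exprM subr_eq0.
  apply/eqP/(mulfI z0); rewrite -exprS mulr1 -[RHS]expf_card cardF; congr (_ ^+ _).
rewrite enum_uniq andbT mem_enum; apply/imsetP => -[z _ uz].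
by have := nz z; rewrite uz eqxx.
Qed.

(** * Points of an Artin-Schreier curve and a lower bound for Kloosterman sums *)

Section LowerBound.

Variables (p k : nat) (F : finFieldType) (iota : {rmorphism 'F_p -> F}).
Variables (psi : F -> algC) (b : 'F_p).
Let Q := (p ^ 2 ^ k)%N.
Hypothesis p_pr : prime p.
Hypothesis p_gt2 : (2 < p)%N.
Hypothesis k_gt0 : (0 < k)%N.
Hypothesis cardF : #|F| = (Q ^ 2)%N.
Hypothesis psi_char : additive_character psi.
Hypothesis psi_frob : forall x, psi (x ^+ p) = psi x.
Hypothesis b0 : b != 0.

Let pF : p \in [pchar F]. Proof. by apply: (rmorph_pchar iota); exact: pchar_Fp. Qed.

Let two0 : (2%:R : F) != 0.
Proof. by rewrite -(dvdn_pcharf pF); apply/negP => /dvdn_leq; lia. Qed.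

Let disc y := (stepanov_disc p (iota (4%:R * b))).[y].

Let half := (Q^2)./2.

Let Q_odd : odd Q.
Proof.
rewrite oddX expn_eq0 /=; case: (even_prime p_pr) => [pe|->] //.
by move: p_gt2; rewrite pe.
Qed.

(** This provides [p < (Q + 1) / 2] for [stepanov]; it rests on [0 < k]. *)
Let Q_lb : (3 * p <= Q)%N.
Proof.
apply: (@leq_trans (p * p)); first by rewrite leq_mul.
rewrite mulnn leq_exp2l; last exact: prime_gt1.
by case: (k) k_gt0 => // n _; rewrite expnS leq_pmulr // expn_gt0.
Qed.

Lemma card_disc_nonsquare :
  (2 * #|[set y | disc y ^+ half == (- 1)%R]| <= Q ^ 2 + 2 * p * Q + 1)%N.
Proof.
have Qh : Q.+1 = (Q.+1./2 * 2)%N by rewrite muln2 -[LHS]odd_double_half /= Q_odd.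
have := @stepanov F p (2 ^ k) Q.+1./2 (iota (4%:R * b)) pF Qh.
move: Qh Q_lb cardF; rewrite -/Q /half; move: (Q.+1./2) => h Qh Qlb cF.
have -> : ((Q ^ 2)./2 = 2 * h * h.-1)%N.
  have -> : (Q ^ 2 = true + (2 * h * h.-1).*2)%N by rewrite -mul2n; nia.
  by rewrite half_bit_double.
have ph : (p < h)%N by lia.
have fb0 : iota (4%:R * b) != 0.
  by rewrite fmorph_eq0 mulf_neq0 // -(fmorph_eq0 iota) rmorph_nat (natrM _ 2 2) mulf_neq0.
move=> /(_ ph cF fb0); rewrite -rmorphXn -{2}(expf_card (4%:R * b)) card_Fp //.
move=> /(_ erefl two0); rewrite -/(disc _).
move: #|_| => n; have -> : ((h + p).-1 = h + p - 1)%N by lia.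
nia.
Qed.

(* Points of [y ^+ p - y = x + b / x], fibred over [y]: the quadratic in [x] has
   discriminant [disc y]. *)
Lemma card_curve_lower :
  (Q ^ 2 <= \sum_(x : F | x != 0%R) #|[set y : F | (y ^+ p - y == x + iota b / x)%R]|
     + (4 * p + 2 * p * Q + 1))%N.
Proof.
have cF : #|F| = (2 * half).+1.
  rewrite cardF -{1}(odd_double_half (Q ^ 2)) mul2n -/half.
  by rewrite -mulnn oddM Q_odd.
pose Y (e : F) := [set y | disc y ^+ half == e].
have szD : size (stepanov_disc p (iota (4%:R * b))) = (2 * p).+1.
  apply: (size_disc pF).
  by rewrite fmorph_eq0 mulf_neq0 // -(fmorph_eq0 iota) rmorph_nat (natrM _ 2 2) mulf_neq0.
have card0 : (#|[set y | disc y == 0%R]| <= 2 * p)%N.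
  rewrite -ltnS -szD cardE; apply: max_poly_roots (enum_uniq _).
    by rewrite -size_poly_eq0 szD.
  by apply/allP => z; rewrite mem_enum inE.
have cardU : (Q ^ 2 <= #|[set y | disc y == 0%R]| + #|Y 1%R| + #|Y (-1)%R|)%N.
  rewrite -cardF -cardsT.
  apply: (@leq_trans #|[set y | disc y == 0%R] :|: Y 1%R :|: Y (-1)%R|).
    apply/subset_leq_card/subsetP => y _; rewrite !inE -orbA.
    have [//|dy0 /=] := eqVneq (disc y) 0.
    have := expf_card (disc y); rewrite cF exprS mulnC exprM => /(canRL (mulKf dy0)).
    by rewrite mulVf // => /eqP; rewrite sqrf_eq1.
  by apply: leq_trans (leq_card_setU _ _) _; rewrite leq_add2r leq_card_setU.
have cardN := card_disc_nonsquare; rewrite -/(Y _) in cardN.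
suff : (2 * #|Y 1%R| <= \sum_(x : F | x != 0%R)
    #|[set y : F | (y ^+ p - y == x + iota b / x)%R]|)%N.
  move: cardN cardU card0.
  set s := (\sum_(_ | _) _)%N; move: s #|Y 1%R| #|Y (-1)%R| => s n1 n2.
  move: #|_| (Q ^ 2)%N (2 * p * Q)%N => n0 q pQ; lia.
under eq_bigr do rewrite -sum1_card.
rewrite (exchange_big_dep predT) //= mulnC -sum_nat_const.
rewrite [leqRHS](bigID (mem (Y 1))) /= -[leqLHS]addn0 leq_add //.
apply: leq_sum => y; rewrite inE => /eqP dy.
have [z dz] := finField_sqrt cF dy.
have half_gt0 : (0 < half)%N.
  by have := finNzRing_gt1 F; rewrite cF; case: (half).
have d0 : disc y != 0.
  apply/eqP => d0; move/eqP: dy; rewrite d0 expr0n gtn_eqF //.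
  by rewrite eq_sym oner_eq0.
have z0 : z != 0 by apply: contraNneq d0 => z0; rewrite dz z0 expr0n.
pose t := y ^+ p - y.
have tz : t ^+ 2 - z ^+ 2 = 4%:R * iota b.
  by rewrite -dz /disc /stepanov_disc /t !hornerE rmorphM rmorph_nat; ring.
(* The two roots of [x^2 - t x + b], that is of [t = x + b / x]. *)
pose x1 := (t + z) / 2%:R; pose x2 := (t - z) / 2%:R.
have x12 : x1 * x2 = iota b.
  have four0 : (4%:R : F) != 0 by rewrite (natrM _ 2 2) mulf_neq0.
  apply: (mulfI four0); rewrite -tz /x1 /x2; field.
  by [].
have x1x2 : x1 + x2 = t by rewrite /x1 /x2; field.
have ib0 : iota b != 0 by rewrite fmorph_eq0.
have nx12 : x1 != x2.
  rewrite -subr_eq0; have -> : x1 - x2 = z by rewrite /x1 /x2; field.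
  by [].
have x10 : x1 != 0 by apply: contraNneq ib0 => e; rewrite -x12 e mul0r.
have x20 : x2 != 0 by apply: contraNneq ib0 => e; rewrite -x12 e mulr0.
rewrite sum1_card; apply: (@leq_trans #|[set x1; x2]|); first by rewrite cards2 nx12.
apply/subset_leq_card/subsetP => x; rewrite !inE => /orP[] /eqP ->.
  by rewrite unfold_in /= x10 inE -/t -x1x2 -x12; apply/eqP; field.
by rewrite unfold_in /= x20 inE -/t -x1x2 -x12; apply/eqP; field.
Qed.

(** If [t = y ^+ p - y], every term is 1 because [psi] agrees on [c y] and its [p]-th power; the sum
    is [p], which bounds the number of such [y]. Otherwise the count is 0 and the sum is 0 or
    [p]. *)
Lemma char_sum_lower t :
  #|[set y : F | y ^+ p - y == t]|%:R <= \sum_(c : 'F_p) psi (iota c * t).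
Proof.
have chi : additive_character (fun c => psi (iota c * t)).
  split=> [|x y]; first by rewrite rmorph0 mul0r (char0 psi_char).
  by rewrite rmorphD mulrDl (charD psi_char).
have cardp : #|'F_p| = p by exact: card_Fp.
have [y /eqP yt|noy] := pickP (fun y => y ^+ p - y == t); last first.
  rewrite (_ : [set y | _] = set0) ?cards0; last by apply/setP => y; rewrite !inE noy.
  have [c c1|all1] := pickP (fun c => psi (iota c * t) != 1).
    by rewrite (sum_char chi c1).
  rewrite (eq_bigr (fun=> 1)) ?sumr_const ?ler0n // => c _.
  by apply/eqP/negPn; rewrite all1.
rewrite (eq_bigr (fun=> 1)) => [|c _].
  rewrite sumr_const cardp ler_nat.
  pose P : {poly F} := 'X^p - 'X - t%:P.
  have szP : size P = p.+1.
    rewrite /P -addrA size_polyDl ?size_polyXn // -opprD size_polyN.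
    by rewrite size_XaddC; have := prime_gt1 p_pr; lia.
  rewrite -ltnS -szP cardE; apply: max_poly_roots (enum_uniq _).
    by rewrite -size_poly_eq0 szP.
  by apply/allP => z; rewrite mem_enum inE /root !hornerE subr_eq0.
have cf : iota c ^+ p = iota c by rewrite -rmorphXn -{2}(expf_card c) cardp.
rewrite -yt mulrBr -{1}cf -exprMn (charD psi_char) psi_frob -(charD psi_char).
by rewrite subrr (char0 psi_char).
Qed.

(** Over all [c], the sum dominates the number of points by [char_sum_lower]. The term [c = 0] is
    [Q^2 - 1] and cancels the main term of [card_curve_lower]. *)
Lemma kloosterman_sum_lower :
  - (4 * p + 2 * p * Q)%:R <=
    \sum_(c : 'F_p | c != 0) kloosterman psi (iota c) (iota (c * b)).
Proof.
have : (\sum_(x : F | x != 0%R) #|[set y : F | (y ^+ p - y == x + iota b / x)%R]|)%N%:R <=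
   \sum_(c : 'F_p) kloosterman psi (iota c) (iota (c * b)).
  rewrite /kloosterman exchange_big /= natr_sum; apply: ler_sum => x x0.
  apply: le_trans (char_sum_lower _) _.
  rewrite le_eqVlt; apply/orP; left; apply/eqP/eq_bigr => c _.
  by rewrite rmorphM mulrDr mulrA.
rewrite (bigD1 (0 : 'F_p)) //= mul0r rmorph0.
have -> : kloosterman psi 0 0 = (Q ^ 2).-1%:R.
  rewrite /kloosterman (eq_bigr (fun=> 1)) => [|x _].
    rewrite sumr_const -cardF -(cardsC1 (0 : F)); congr (_ *+ _).
    by apply: eq_card => x; rewrite !inE.
  by rewrite !mul0r addr0 (char0 psi_char).
have Q20 : (0 < Q ^ 2)%N by rewrite !expn_gt0 prime_gt0.
move=> H; rewrite lerNl; rewrite -lerBlDl in H.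
rewrite -lerN2 opprK; apply: le_trans H.
have : (Q ^ 2)%:R <= (\sum_(x : F | x != 0%R) #|[set y : F | (y ^+ p - y == x + iota b / x)%R]|)%N%:R
     + (4 * p + 2 * p * Q + 1)%:R :> algC.
  by rewrite -natrD ler_nat card_curve_lower.
rewrite -subn1 natrB // natrD => H.
rewrite lerBrDl -subr_ge0; rewrite -subr_ge0 in H.
by apply: le_trans H _; rewrite le_eqVlt; apply/orP; left; apply/eqP; ring.
Qed.

End LowerBound.

(** The recursion of [kloosterman_quadratic], started from a sum [K] over the prime field. *)
Fixpoint kloosterman_iter (p : nat) (K : algC) (k : nat) : algC :=
  if k is n.+1 then (p ^ 2 ^ n)%:R *+ 2 - kloosterman_iter p K n ^+ 2 else K.

(** * The tower of quadratic extensions and Weil's bound *)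

Section Weil.

Variables (p : nat) (psi : 'F_p -> algC) (x0 : 'F_p).
Hypothesis p_pr : prime p.
Hypothesis psi_char : additive_character psi.
Hypothesis psi_x0 : psi x0 != 1.

Lemma kloosterman_tower k : (2 < p)%N ->
  exists F : finFieldType, exists iota : {rmorphism 'F_p -> F}, exists chi : F -> algC,
  [/\ #|F| = (p ^ 2 ^ k)%N, additive_character chi,
      forall x, chi (x ^+ p) = chi x, exists x, chi x != 1 &
      forall a b : 'F_p, a != 0 -> b != 0 ->
        kloosterman chi (iota a) (iota b) = kloosterman_iter p (kloosterman psi a b) k].
Proof.
move=> p_gt2; have cardp : #|'F_p| = p by exact: card_Fp.
elim: k => [|k [F [iota [chi [cardF chiC chip [x chix] chiK]]]]].
  exists 'F_p, idfun, psi; split=> // [x|]; last by exists x0.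
  by congr psi; rewrite -[RHS]expf_card cardp.
have [E [j cardE]] := quadratic_extension F.
exists E, (j \o iota), (chi \o qtrace j).
have pF : p \in [pchar F] by apply: (rmorph_pchar iota); exact: pchar_Fp.
split.
- by rewrite cardE cardF -expnM expnSr.
- exact: additive_character_qtrace.
- by move=> y /=; rewrite qtrace_pchar.
- have two0 : (2%:R : F) != 0 by rewrite -(dvdn_pcharf pF); apply/negP => /dvdn_leq; lia.
  (* An element of the smaller field has trace equal to its double. *)
  exists (j (x / 2%:R)) => /=; rewrite (_ : qtrace j _ = x) //.
  apply: (fmorph_inj j); rewrite (qtraceE j cardE) frob_fixed -rmorphD.
  by congr (j _); field.
move=> a b a0 b0 /=; rewrite -(chiK a b a0 b0) -cardF.
by apply: kloosterman_quadratic chix _ _; rewrite ?fmorph_eq0.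
Qed.

Lemma kloosterman_iter_real a b k : kloosterman_iter p (kloosterman psi a b) k \is Num.real.
Proof.
elim: k => [|k IHk] /=; first exact: kloosterman_real.
by apply: rpredB; [exact: rpredMn (realn _ _) | exact: rpredX].
Qed.

(** The recursion bounds each sum above by [2 Q], with [Q^2] the size of the field; a lower bound
    for their total over [c] then bounds each one below. *)
Lemma kloosterman_iter_bound b k : (2 < p)%N -> b != 0 -> (0 < k)%N ->
  kloosterman_iter p (kloosterman psi 1 b) k.+1 ^+ 2 <= ((8 * p) ^ 2 * p ^ 2 ^ k.+1)%:R.
Proof.
move=> p_gt2 b0 k_gt0.
have [F [iota [chi [cardF chiC chip _ chiK]]]] := kloosterman_tower k.+1 p_gt2.
pose Q := (p ^ 2 ^ k)%N; have QE : (p ^ 2 ^ k.+1 = Q ^ 2)%N by rewrite -expnM expnSr.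
pose kl c := kloosterman_iter p (kloosterman psi c (c * b)) k.+1.
have klQ c : kl c <= (2 * Q)%:R.
  rewrite /kl /= natrM mulr_natl -/Q -subr_ge0 opprB addrCA subrr addr0.
  by rewrite real_exprn_even_ge0 // kloosterman_iter_real.
rewrite QE in cardF.
have low : - (4 * p + 2 * p * Q)%:R <= \sum_(c : 'F_p | c != 0) kl c.
  apply: le_trans (kloosterman_sum_lower iota p_pr p_gt2 k_gt0 cardF chiC chip b0) _.
  by rewrite (eq_bigr kl) // => c c0; rewrite chiK ?mulf_neq0.
have Q_gt0 : (0 < Q)%N by rewrite expn_gt0 prime_gt0.
(* The other terms add up to at most [2 p Q], so [kl 1] is at least [- (4 p + 2 p Q) - 2 p Q]. *)
have kl1 : - (8 * p * Q)%:R <= kl 1.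
  move: low; rewrite (bigD1 1) ?oner_eq0 //= -lerBlDr; apply: le_trans.
  rewrite lerBrDr -lerBrDl opprK.
  have : \sum_(c : 'F_p | (c != 0) && (c != 1)) kl c <= (p * (2 * Q))%:R.
    apply: (@le_trans _ _ (\sum_(c : 'F_p) (2 * Q)%:R)).
      by rewrite big_mkcond /=; apply: ler_sum => c _; case: ifP.
    by rewrite sumr_const card_Fp // -(mulr_natl _ p) -natrM.
  move/le_trans; apply; rewrite -lerBlDl opprK -natrD ler_nat; nia.
have -> : kloosterman psi 1 b = kloosterman psi 1 (1 * b) by rewrite mul1r.
rewrite -/(kl 1) QE natrM natrX [(Q ^ 2)%:R]natrX -exprMn -natrM.
rewrite -real_normK ?kloosterman_iter_real // ler_pXn2r ?nnegrE ?normr_ge0 ?ler0n //.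
rewrite real_ler_norml ?kloosterman_iter_real // kl1 /=.
by apply: le_trans (klQ 1) _; rewrite ler_nat leq_mul2r; apply/orP; right; lia.
Qed.

(* If [K ^ 2 > 4 p], the excess [W_k = K_k ^ 2 - 4 q_k] satisfies [W_(k+1) = K_k ^ 2 W_k
   >= 4 q_k W_k], so [W_k / q_k] grows like [4 ^ k], against [kloosterman_iter_bound]. *)
Lemma weil_1 b : b != 0 -> kloosterman psi 1 b ^+ 2 <= (4 * p)%:R.
Proof.
move=> b0; have [p_le2|p_gt2] := leqP p 2.
  (* For [p = 2] the trivial bound suffices. *)
  have n1 : `|kloosterman psi 1 b| <= (p.-1)%:R.
    rewrite /kloosterman; apply: le_trans (ler_norm_sum _ _ _) _.
    rewrite (eq_bigr (fun=> 1)) => [|x _]; last exact: norm_char.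
    have -> : p.-1 = #|[set~ (0 : 'F_p)]| by rewrite cardsC1 card_Fp.
    rewrite sumr_const ler_nat; apply/subset_leq_card/subsetP => x.
    by rewrite !inE.
  rewrite -real_normK ?kloosterman_real //.
  apply: (@le_trans _ _ (p.-1%:R ^+ 2)); first by rewrite ler_pXn2r ?nnegrE ?normr_ge0 ?ler0n.
  by rewrite -natrX ler_nat; case: (p) p_le2 => [|[|[|]]].
rewrite real_leNgt ?rpredX ?kloosterman_real ?realn //; apply/negP => Kp.
pose K k := kloosterman_iter p (kloosterman psi 1 b) k.
pose q k : algC := (p ^ 2 ^ k)%:R.
pose W k := K k ^+ 2 - 4%:R * q k.
have q_gt0 k : 0 < q k by rewrite ltr0n expn_gt0 prime_gt0.
have qS k : q k.+1 = q k ^+ 2 by rewrite /q -natrX -expnM expnSr.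
have WS k : W k.+1 = K k ^+ 2 * W k.
  by rewrite /W qS {1}/K /= -/(K k) -/(q k); ring.
have W0 : 0 < W 0%N by rewrite subr_gt0 /q expn0 expn1 -natrM.
pose r := W 0%N / p%:R.
have p0 : 0 < p%:R :> algC by rewrite ltr0n prime_gt0.
have r_gt0 : 0 < r by rewrite divr_gt0.
have Wk k : 4%:R ^+ k * r * q k <= W k.
  elim: k => [|k IHk].
    by rewrite expr0 mul1r /q expn0 expn1 /r divfK ?gt_eqF.
  have Wpos : 0 <= W k.
    apply: le_trans IHk; apply: mulr_ge0 (ltW (q_gt0 k)).
    by apply: mulr_ge0 (ltW r_gt0); rewrite exprn_ge0 ?ler0n.
  have : 4%:R * q k <= K k ^+ 2 by rewrite -subr_ge0.
  move=> KQ; rewrite WS qS; apply: le_trans (ler_wpM2r Wpos KQ).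
  rewrite exprS expr2; apply: le_trans (ler_wpM2l _ IHk); last first.
    by rewrite mulr_ge0 ?ler0n // ltW.
  by rewrite le_eqVlt; apply/orP; left; apply/eqP; ring.
have bound k : 4%:R ^+ k.+2 * r <= ((8 * p) ^ 2)%:R.
  have := kloosterman_iter_bound p_gt2 b0 (ltn0Sn k).
  rewrite -/(K k.+2) natrM -/(q k.+2) => KQ.
  rewrite -(ler_pM2r (q_gt0 k.+2)); apply: le_trans (Wk _) _; apply: le_trans KQ.
  by rewrite /W lerBlDr lerDl mulr_ge0 ?ler0n // ltW.
(* By [bound], [4 ^ (n + 2)] would be at most [(8 p)^2 / r], hence below [n]. *)
pose n := Num.bound (((8 * p) ^ 2)%:R / r : algC).
have c_ge0 : 0 <= ((8 * p) ^ 2)%:R / r by rewrite divr_ge0 ?ler0n // ltW.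
have := le_lt_trans _ (archi_boundP c_ge0).
move=> /(_ (4%:R ^+ n.+2)); rewrite ler_pdivlMr // bound => /(_ isT).
rewrite -/n -natrX ltr_nat ltnNge (leq_trans (ltnW (ltnSn n))) //.
by rewrite (leq_trans (ltnW (ltnSn n.+1))) // ltnW // ltn_expl.
Qed.

Lemma weil a b : a != 0 -> b != 0 -> kloosterman psi a b ^+ 2 <= (4 * p)%:R.
Proof.
move=> a0 b0; rewrite (kloosterman_scale _ _ a0); apply: weil_1.
by rewrite mulf_neq0.
Qed.

End Weil.

(** * Points of the modular hyperbola in boxes *)

Lemma exists_additive_character (p : nat) : prime p ->
  exists2 psi : 'F_p -> algC, additive_character psi & exists x, psi x != 1.
Proof.
move=> p_pr; have [z zp] := C_prim_root_exists (prime_gt0 p_pr).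
exists (fun x : 'F_p => z ^+ x).
  split=> [|x y]; first by rewrite expr0.
  rewrite -exprD -(prim_expr_mod zp (_ + _)) /=; congr (_ ^+ _).
  by congr modn; exact: Fp_cast.
exists 1; rewrite -(prim_order_dvd zp) /=.
by rewrite dvdn1 gtn_eqF // prime_gt1.
Qed.

(** Lagrange's identity writes twice the defect as a sum of weighted squares. *)
Lemma cauchy_schwarz_weighted (I : finType) (P : pred I) (w t : I -> algC) :
  (forall i, 0 <= w i) -> (forall i, t i \is Num.real) ->
  (\sum_(i | P i) w i * t i) ^+ 2 <=
    (\sum_(i | P i) w i) * \sum_(i | P i) w i * t i ^+ 2.
Proof.
move=> w0 tR; rewrite -subr_ge0 -(pmulr_rge0 _ (ltr0n _ 2)).
suff -> : 2%:R * ((\sum_(i | P i) w i) * (\sum_(i | P i) w i * t i ^+ 2) -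
     (\sum_(i | P i) w i * t i) ^+ 2) =
   \sum_(i | P i) \sum_(j | P j) w i * w j * (t i - t j) ^+ 2.
  apply: sumr_ge0 => i _; apply: sumr_ge0 => j _; apply: mulr_ge0; first exact: mulr_ge0.
  by rewrite real_exprn_even_ge0 // rpredB.
rewrite [RHS](eq_bigr (fun i => \sum_(j | P j) (w i * t i ^+ 2 * w j + w i * (w j * t j ^+ 2)
   - (w i * t i) * (w j * t j) *+ 2))) => [|i _ /=]; last first.
  by apply: eq_bigr => j _; ring.
under [RHS]eq_bigr do rewrite sumrB big_split /= -!mulr_sumr sumrMnl -mulr_sumr.
rewrite sumrB big_split /= -!mulr_suml sumrMnl -mulr_suml; ring.
Qed.

(** * Fourier analysis of the count of solutions in boxes *)

Section Hyperbola.

Variables (p : nat) (psi : 'F_p -> algC) (x0 : 'F_p).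
Hypothesis p_pr : prime p.
Hypothesis psi_char : additive_character psi.
Hypothesis psi_x0 : psi x0 != 1.
Implicit Types (A B : {set 'F_p}) (a b t : 'F_p).

(** The Fourier coefficients of the Fejer weight of [A], whose values are [diff_count]. *)
Definition diff_transform A a := `|\sum_(u in A) psi (a * u)| ^+ 2.

Definition diff_count A t := #|[set w in setX A A | w.1 - w.2 + t == 0]|.

Lemma sum_diff_transform A t :
  \sum_a diff_transform A a * psi (a * t) = (p * diff_count A t)%:R.
Proof.
under eq_bigr => a _.
  rewrite /diff_transform normCK rmorph_sum big_distrlr pair_big mulr_suml /=.
  under eq_bigr => w _ do
    rewrite -(charN psi_char) -!(charD psi_char) -mulrBr -mulrDr.
  over.
rewrite exchange_big /=.
under eq_bigr => w _ do rewrite (sum_charM psi_char _ psi_x0) card_Fp //.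
rewrite -big_mkcondr sumr_const -(mulr_natr p%:R) -natrM; congr ((_ * _)%:R).
by apply: eq_card => w; rewrite !inE unfold_in.
Qed.

Lemma diff_transform_ge0 A a : 0 <= diff_transform A a.
Proof. by rewrite exprn_ge0. Qed.

Lemma diff_transform0 A : diff_transform A 0 = (#|A| ^ 2)%:R.
Proof.
rewrite /diff_transform (eq_bigr (fun=> 1)) => [|u _]; last by rewrite mul0r char0.
by rewrite sumr_const normr_nat natrX.
Qed.

Lemma diff_count_le A t : (diff_count A t <= #|A|)%N.
Proof.
rewrite /diff_count -(card_in_imset (f := fst) (D := [set w in setX A A | w.1 - w.2 + t == 0])).
  by apply/subset_leq_card/subsetP => x /imsetP[[u v] + ->]; rewrite !inE /= => /andP[/andP[]].
move=> [u v] [u' v']; rewrite !inE /= => /andP[_ e] /andP[_ e'] uu; subst u'.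
congr pair; by move: e; rewrite -(eqP e') => /eqP/addIr/addrI/oppr_inj.
Qed.

Lemma diff_count0 A : diff_count A 0 = #|A|.
Proof.
apply/eqP; rewrite eqn_leq diff_count_le /=.
rewrite -(card_imset _ (f := fun u : 'F_p => (u, u))) => [|u v []] //.
apply/subset_leq_card/subsetP => _ /imsetP[u uA ->].
by rewrite !inE /= uA subrr addr0 eqxx.
Qed.

Lemma sum_diff_transform0 A : \sum_a diff_transform A a = (p * #|A|)%:R.
Proof.
rewrite -(diff_count0 A) -sum_diff_transform; apply: eq_bigr => a _.
by rewrite mulr0 char0 // mulr1.
Qed.

Lemma sum_char_neq0 a : a != 0 -> \sum_(x | x != 0) psi (a * x) = -1.
Proof.
move=> a0; apply/eqP; rewrite -addr_eq0 addrC; apply/eqP.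
have := sum_charM psi_char a psi_x0; rewrite (negPf a0) (bigD1 0) //= mul0r char0 //.
by under eq_bigr do rewrite mulrC.
Qed.

(** When exactly one argument vanishes, the sum is -1. *)
Lemma kloosterman_norm a b : (a, b) != (0, 0) -> `|kloosterman psi a b| ^+ 2 <= (4 * p)%:R.
Proof.
move=> ab0; have [a0|a0] := eqVneq a 0; have [b0|b0] := eqVneq b 0.
- by rewrite a0 b0 eqxx in ab0.
- rewrite /kloosterman (reindex_inj invr_inj) /=.
  rewrite (eq_big (fun x => x != 0) (fun x => psi (b * x))) => [||x _].
  + by rewrite sum_char_neq0 // normrN normr1 expr1n ler1n muln_gt0 (prime_gt0 p_pr).
  + by move=> x; rewrite invr_eq0.
  + by rewrite a0 mul0r add0r invrK.
- rewrite /kloosterman (eq_bigr (fun x => psi (a * x))) => [|x _].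
    by rewrite sum_char_neq0 // normrN normr1 expr1n ler1n muln_gt0 (prime_gt0 p_pr).
  by rewrite b0 mul0r addr0.
- by rewrite real_normK ?kloosterman_real //; exact: weil psi_x0 _ _ _ _.
Qed.

(** Without solutions the zero frequency must be cancelled by the others, which Weil's bound and
    Cauchy-Schwarz keep small; [T] bounds the number of centres close to a given one. *)
Lemma hyperbola_count (I : finType) (m n : I -> 'F_p) A B (T : nat) :
  (forall j u u' v v', u \in A -> u' \in A -> v \in B -> v' \in B ->
     (m j + (u - u')) * (n j + (v - v')) != 1) ->
  (forall j, #|[set l | diff_count A (m l - m j)%R != 0%N]| <= T)%N ->
  (#|I| * (#|A| * #|B| * p.-1) ^ 2 <= 4 * p ^ 5 * T)%N.
Proof.
move=> nosol close.
pose w (c : 'F_p * 'F_p) := diff_transform A c.1 * diff_transform B c.2.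
pose G (c : 'F_p * 'F_p) := \sum_j psi (- (c.1 * m j + c.2 * n j)).
pose K (c : 'F_p * 'F_p) := kloosterman psi c.1 c.2.
have w_ge0 c : 0 <= w c by rewrite mulr_ge0 ?diff_transform_ge0.
have sum_w : \sum_c w c = (p * #|A| * (p * #|B|))%:R.
  rewrite natrM -!sum_diff_transform0 big_distrlr pair_big /=.
  by apply: eq_bigr => -[].
(* Up to the factor [p^2], this is the weighted number of solutions in all boxes. *)
have sum_wGK : \sum_c w c * (G c * K c) = 0.
  transitivity (\sum_j \sum_(x : 'F_p | x != 0)
     ((p * diff_count A (x - m j)) * (p * diff_count B (x^-1 - n j)))%:R : algC).
    rewrite /G /K /kloosterman.
    under eq_bigr do rewrite big_distrlr mulr_sumr /=.
    rewrite exchange_big /=; apply: eq_bigr => j _.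
    under eq_bigr do rewrite mulr_sumr.
    rewrite exchange_big /=; apply: eq_bigr => x _.
    rewrite natrM -!sum_diff_transform big_distrlr pair_big /=.
    apply: eq_bigr => -[a b] _; rewrite /w /= [RHS]mulrACA; congr (_ * _).
    rewrite -!(charD psi_char); congr psi; ring.
  apply: big1 => j _; apply: big1 => x x00; apply/eqP; rewrite pnatr_eq0 !muln_eq0.
  apply/negPn; rewrite !negb_or -!andbA; apply/negP => /and4P[_ + _].
  rewrite -!lt0n => /card_gt0P[[u u'] +] /card_gt0P[[v v'] +].
  rewrite !inE /= => /andP[/andP[uA u'A] e] /andP[/andP[vB v'B] e'].
  have /eqP := nosol j u' u v' v u'A uA v'B vB; apply.
  have -> : m j + (u' - u) = x - (u - u' + (x - m j)) by ring.
  have -> : n j + (v' - v) = x^-1 - (v - v' + (x^-1 - n j)) by ring.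
  by rewrite (eqP e) (eqP e') !subr0 mulfV.
(* Parseval over pairs [(j, l)]: the count for [A] vanishes unless [m l] is close to [m j], and the
   count for [B] is bounded by [#|B|]. *)
have sum_wG2 : \sum_c w c * `|G c| ^+ 2 <= (p ^ 2 * #|I| * T * #|A| * #|B|)%:R.
  have -> : \sum_c w c * `|G c| ^+ 2 = \sum_j \sum_l
     ((p * diff_count A (m l - m j)) * (p * diff_count B (n l - n j)))%:R.
    rewrite /G; under eq_bigr do rewrite normCK rmorph_sum big_distrlr mulr_sumr /=.
    rewrite exchange_big /=; apply: eq_bigr => j _.
    under eq_bigr do rewrite mulr_sumr.
    rewrite exchange_big /=; apply: eq_bigr => l _.
    rewrite natrM -!sum_diff_transform big_distrlr pair_big /=.
    apply: eq_bigr => -[a b] _; rewrite /w /= [RHS]mulrACA; congr (_ * _).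
    rewrite -(charN psi_char) -!(charD psi_char); congr psi; ring.
  under eq_bigr do rewrite -natr_sum.
  rewrite -natr_sum ler_nat.
  have -> : (p ^ 2 * #|I| * T * #|A| * #|B| = \sum_(j : I) (T * (p * #|A| * (p * #|B|))))%N.
    by rewrite sum_nat_const; ring.
  apply: leq_sum => j _; apply: leq_trans (leq_mul (close j) (leqnn _)).
  rewrite -sum_nat_const [leqRHS]big_mkcond /=; apply: leq_sum => l _; rewrite inE.
  case: eqP => [->|_] /=; first by rewrite muln0 mul0n.
  by rewrite leq_mul ?leq_mul ?diff_count_le.
(* The left side is the term of frequency [(0, 0)]. *)
have main : ((#|A| ^ 2 * #|B| ^ 2 * (#|I| * p.-1))%:R : algC) <=
    \sum_(c | c != (0, 0)) w c * (`|G c| * `|K c|).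
  rewrite (bigD1 (0, 0)) //= in sum_wGK.
  have -> : ((#|A| ^ 2 * #|B| ^ 2 * (#|I| * p.-1))%:R : algC) =
     `|- (w (0, 0) * (G (0, 0) * K (0, 0)))|.
    rewrite normrN /w /= !diff_transform0 /G /K /kloosterman /=.
    rewrite (eq_bigr (fun=> 1)) => [|j _]; last by rewrite !mul0r addr0 oppr0 char0.
    rewrite [X in _ * (_ * X)](eq_bigr (fun=> 1)) => [|j _]; last first.
      by rewrite !mul0r addr0 char0.
    rewrite !sumr_const -!natrM normr_nat.
    have -> : p.-1 = #|[set~ (0 : 'F_p)]| by rewrite cardsC1 card_Fp.
    by congr (_ * (_ * _))%:R; apply: eq_card => x; rewrite !inE.
  move/eqP: sum_wGK; rewrite addrC addr_eq0 => /eqP <-.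
  apply: le_trans (ler_norm_sum _ _ _) _; apply: ler_sum => c _.
  by rewrite normrM (ger0_norm (w_ge0 c)) normrM.
have : ((#|A| ^ 2 * #|B| ^ 2 * (#|I| * p.-1)) ^ 2 <=
   p * #|A| * (p * #|B|) * (4 * p * (p ^ 2 * #|I| * T * #|A| * #|B|)))%N.
  rewrite -(ler_nat algC) natrX.
  apply: (@le_trans _ _ ((\sum_(c | c != (0, 0)) w c * (`|G c| * `|K c|)) ^+ 2)).
    by rewrite ler_pXn2r // ?nnegrE ?ler0n // (le_trans _ main).
  apply: le_trans (cauchy_schwarz_weighted _ w_ge0 _) _.
    by move=> c; rewrite realE mulr_ge0.
  rewrite natrM; apply: ler_pM; first exact: sumr_ge0.
  - by apply: sumr_ge0 => c _; rewrite mulr_ge0 // exprn_ge0 // mulr_ge0.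
  - rewrite -sum_w [leRHS](bigID (fun c => c != (0, 0))) /= lerDl.
    exact: sumr_ge0.
  rewrite natrM; apply: (@le_trans _ _ ((4 * p)%:R * \sum_c w c * `|G c| ^+ 2)).
    rewrite mulr_sumr [leRHS](bigID (fun c => c != (0, 0))) /=.
    rewrite -[leLHS]addr0 lerD //; last first.
      by apply: sumr_ge0 => c _; rewrite !mulr_ge0 ?ler0n // exprn_ge0.
    apply: ler_sum => -[a b] c0; rewrite exprMn [leLHS]mulrA [leLHS]mulrC.
    apply: ler_wpM2r; first by rewrite mulr_ge0 // exprn_ge0.
    exact: kloosterman_norm.
  by rewrite ler_wpM2l // ler0n.
move=> H; have [->|I0] := posnP #|I|; first by rewrite mul0n.
have [->|A0] := posnP #|A|; first by rewrite !mul0n exp0n // muln0.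
have [->|B0] := posnP #|B|; first by rewrite muln0 mul0n exp0n // muln0.
move: #|I| #|A| #|B| p.-1 I0 A0 B0 H => i a b q i0 a0 b0 H.
rewrite -(leq_pmul2l (_ : 0 < i * (a * b) ^ 2)%N); last first.
  by rewrite muln_gt0 i0 expn_gt0 muln_gt0 a0 b0.
apply: leq_trans (leq_trans (eq_leq _) H) (eq_leq _); ring.
Qed.

End Hyperbola.

(** Apply [hyperbola_count] to the residues of [0, ..., h] and [0, ..., k]: they are distinct as
    [h, k < p], and their differences stay within [h] and [k] of 0. *)
Lemma hyperbola_count_int (p J h k T : nat) (M N : 'I_J -> int) :
  prime p -> (h < p)%N -> (k < p)%N ->
  (forall j (x y : int), `|x - M j| <= h%:Z -> `|y - N j| <= k%:Z ->
     ~ (x * y = 1 %[mod p%:Z])%Z) ->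
  (forall j (S : {set 'I_J}),
     (forall l, l \in S -> exists2 s : int, `|s| <= h%:Z & (p%:Z %| M l - M j - s)%Z) ->
     (#|S| <= T)%N) ->
  (J * (h.+1 * k.+1 * p.-1) ^ 2 <= 4 * p ^ 5 * T)%N.
Proof.
move=> p_pr hp kp nosol close.
have pF : p \in [pchar 'F_p] by exact: pchar_Fp.
have [psi psi_char [x0 psi_x0]] := exists_additive_character p_pr.
pose A n : {set 'F_p} := [set (i%:R : 'F_p) | i : 'I_n.+1].
have cardA n : (n < p)%N -> #|A n| = n.+1.
  move=> np; rewrite card_in_imset ?card_ord // => i j _ _ /(congr1 val).
  rewrite /= !val_Fp_nat // !modn_small; first by move/val_inj.
    by rewrite (leq_trans (ltn_ord j)).
  by rewrite (leq_trans (ltn_ord i)).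
have dist n (i i' : 'I_n.+1) : `|i%:Z - i'%:Z| <= n%:Z.
  by have := ltn_ord i; have := ltn_ord i'; lia.
rewrite -(cardA h) // -(cardA k) // -[X in (X * _)%N]card_ord.
apply: (hyperbola_count p_pr psi_char psi_x0
  (m := fun j => (M j)%:~R) (n := fun j => (N j)%:~R)).
  move=> j _ _ _ _ /imsetP[i _ ->] /imsetP[i' _ ->] /imsetP[l _ ->] /imsetP[l' _ ->].
  apply/negP => e; apply: (nosol j (M j + (i%:Z - i'%:Z)) (N j + (l%:Z - l'%:Z))).
  - by rewrite addrAC subrr add0r dist.
  - by rewrite addrAC subrr add0r dist.
  apply/eqP; rewrite eqz_mod_dvd (dvdz_pcharf pF) intrB subr_eq0.
  by rewrite intrM !intrD !intrN.
move=> j; apply: (close j) => l; rewrite inE -lt0n => /card_gt0P[[u u']].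
rewrite !inE /= => /andP[/andP[/imsetP[i _ ->] /imsetP[i' _ ->]] e].
exists (i'%:Z - i%:Z); first exact: dist.
rewrite (dvdz_pcharf pF) !intrB -(eqP e); apply/eqP; ring.
Qed.

(** * Spaced centres and centred intervals *)

Lemma dist_nearest_int_le (R : realType) (z : R) (t : int) :
  dist_nearest_int z <= `|z - t%:~R|.
Proof.
apply: ge_inf; last by exists t.
by exists 0 => _ [n _ <-].
Qed.

(** Pigeonhole: cut the [2 h + 1] possible shifts into blocks of length [n], the integer part of
    [X]. Two centres in one block would be less than [n <= X] apart modulo [p]. *)
Lemma spaced_count (R : realType) (p J h : nat) (X : R) (M : 'I_J -> int) :
  (0 < p)%N -> 1 <= X ->
  (forall j k, j != k -> X <= p%:R * dist_nearest_int ((M j - M k)%:~R / p%:R)) ->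
  forall j (S : {set 'I_J}),
    (forall l, l \in S -> exists2 s : int, `|s| <= h%:Z & (p%:Z %| M l - M j - s)%Z) ->
    (#|S| <= (2 * h) %/ Num.truncn X + 1)%N.
Proof.
move=> p0 X1 spaced j S HS; set n := Num.truncn X.
have n0 : (0 < n)%N by rewrite truncn_gt0.
have nX : n%:R <= X by rewrite truncn_le (le_trans ler01).
(* Shifts in [[-h, h]] are stored as [0, ..., 2 h]; the default in [f] is taken only outside [S]. *)
pose near l (s : 'I_(2 * h).+1) := (p%:Z %| M l - M j - (s%:Z - h%:Z))%Z.
pose f l := odflt ord0 [pick s | near l s].
have fP l : l \in S -> near l (f l).
  move=> lS; rewrite /f; case: pickP => // no; have [s sh ps] := HS l lS.
  have sh' : (absz (s + h%:Z)%R < (2 * h).+1)%N by lia.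
  have := no (Ordinal sh'); rewrite /near /= (_ : (absz (s + h%:Z))%:Z - h%:Z = s) ?ps //.
  lia.
have gP l : (f l %/ n < (2 * h) %/ n + 1)%N.
  by rewrite addn1 ltnS leq_div2r // -ltnS ltn_ord.
rewrite -[X in (_ <= X)%N]card_ord; apply: (@leq_card_in _ _ (fun l => Ordinal (gP l))).
move=> l l' lS l'S /(congr1 val) /= fll; apply/eqP/negPn/negP => nll.
have /dvdzP[t ht] : (p%:Z %| (M l - M l') - ((f l)%:Z - (f l')%:Z))%Z.
  have -> : (M l - M l') - ((f l)%:Z - (f l')%:Z) =
     (M l - M j - ((f l)%:Z - h%:Z)) - (M l' - M j - ((f l')%:Z - h%:Z)) by ring.
  by apply: rpredB; exact: fP.
have lt_n : `|(f l)%:Z - (f l')%:Z| < n%:Z.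
  have := divn_eq (f l) n; have := divn_eq (f l') n; rewrite fll.
  have := ltn_mod (f l) n; have := ltn_mod (f l') n; rewrite n0; lia.
have p0R : 0 < p%:R :> R by rewrite ltr0n.
have := le_trans (spaced l l' nll) (ler_wpM2l (ltW p0R) (dist_nearest_int_le _ t)).
rewrite -{1}(gtr0_norm p0R) -normrM mulrBr mulrCA divff ?gt_eqF // mulr1.
have -> : (M l - M l')%:~R - p%:R * t%:~R = ((f l)%:Z - (f l')%:Z)%:~R :> R.
  rewrite -[p%:R]/(p%:Z%:~R) -intrM -intrB; congr (_%:~R).
  by rewrite [_ * t]mulrC -ht opprB addrC subrK.
rewrite -intr_norm => XX; have := le_trans nX XX.
by rewrite -[n%:R]/(n%:Z%:~R) ler_int leNgt lt_n.
Qed.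

Lemma centered_itvP (R : realType) (I : set R) (c : int) (L : R) (h : nat) (x : int) :
  closed_interval_centered I c%:~R L -> h%:R <= L / 2 ->
  `|x - c| <= h%:Z -> I x%:~R.
Proof.
move=> [a [b [_ -> bL cE]]] hL xc /=.
have : (`|x - c|%:~R : R) <= h%:R by rewrite -[h%:R]/(h%:Z%:~R) ler_int.
rewrite intr_norm intrB ler_norml => /andP[l u].
rewrite in_itv /=; apply/andP; split; lra.
Qed.

Lemma centered_itv_lt (R : realType) (I : set R) (c L b : R) :
  closed_interval_centered I c L -> (I `<=` `]0, b[)%classic -> L < b.
Proof.
move=> [u [v [uv -> vL _]]] sub.
have /sub : `[u, v]%classic u by rewrite /= in_itv /= lexx.
have /sub : `[u, v]%classic v by rewrite /= in_itv /= lexx andbT.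
rewrite /= !in_itv /= => /andP[_ vb] /andP[u0 _]; lra.
Qed.

(** * Choice of constants and conclusion *)

Local Open Scope classical_set_scope.
Local Open Scope ring_scope.

Theorem theorem3 (R : realType) (eps : R) (eps_gt0 : 0 < eps) :
  exists2 C : R, 0 < C &
  forall (p J : nat) (H K X : R) (I1 I2 : 'I_J -> set R) (M N : 'I_J -> int),
    prime p -> (1 <= J)%N -> 0 < H -> 0 < K -> 1 <= X ->
    (forall j, I1 j `<=` `]0, p%:R[%classic) ->
    (forall j, I2 j `<=` `]0, p%:R[%classic) ->
    (forall j, closed_interval_centered (I1 j) (M j)%:~R H) ->
    (forall j, closed_interval_centered (I2 j) (N j)%:~R K) ->
    (forall j k, j != k ->
       X <= p%:R * dist_nearest_int ((M j - M k)%:~R / p%:R)) ->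
    C * (p%:R ^+ 3 * (ln p%:R) `^ (3 + eps) / (H * K ^+ 2 * Num.min H X))
      <= J%:R ->
    exists (j : 'I_J) (x y : int),
      [/\ I1 j x%:~R, I2 j y%:~R & (x * y = 1 %[mod p%:Z])%Z].
Proof.
have ln2 : 0 < ln (2%:R : R) by rewrite ln_gt0 // ltr1n.
have L2 : 0 < ln (2%:R : R) `^ (3 + eps) by rewrite powR_gt0.
(* As [p >= 2], dividing by this power of [ln 2] turns the hypothesis into
   [J >= 1000 p^3 / (H K^2 min (H, X))], which exceeds the bound with 768 proved below. *)
exists (1000%:R / ln (2%:R : R) `^ (3 + eps)); first by rewrite divr_gt0 ?ltr0n.
move=> p J H K X I1 I2 M N p_pr J1 H0 K0 X1 sub1 sub2 cen1 cen2 spaced bigJ.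
apply: contrapT => nosol.
have j0 : 'I_J := Ordinal J1.
have Hp := centered_itv_lt (cen1 j0) (sub1 j0).
have Kp := centered_itv_lt (cen2 j0) (sub2 j0).
have Hh : 0 <= H / 2 by lra.
have Kh : 0 <= K / 2 by lra.
pose h := Num.truncn (H / 2); pose k := Num.truncn (K / 2); pose n := Num.truncn X.
have /andP[hH Hh1] := truncn_itv Hh; rewrite -/h in hH Hh1.
have /andP[kK Kk1] := truncn_itv Kh; rewrite -/k in kK Kk1.
have /andP[nX Xn] : n%:R <= X < n.+1%:R by apply: truncn_itv; lra.
have n1 : 1 <= n%:R :> R by rewrite ler1n truncn_gt0.
have hp : (h < p)%N by rewrite -(ltr_nat R); lra.
have kp : (k < p)%N by rewrite -(ltr_nat R); lra.
have p2 := prime_gt1 p_pr.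
have count : (J * (h.+1 * k.+1 * p.-1) ^ 2 <= 4 * p ^ 5 * ((2 * h) %/ n + 1))%N.
  apply: (@hyperbola_count_int _ _ _ _ _ M N p_pr hp kp).
    move=> j x y xM yN xy; apply: nosol; exists j, x, y; split=> //.
      exact: (centered_itvP (cen1 j) hH).
    exact: (centered_itvP (cen2 j) kK).
  exact: (spaced_count (ltnW p2) X1 spaced).
set m := Num.min H X in bigJ.
have m0 : 0 < m by rewrite lt_min H0 /=; lra.
have mH : m <= H by rewrite ge_min lexx.
have mX : m <= X by rewrite ge_min lexx orbT.
set d := ((2 * h) %/ n)%N in count.
have dn : d%:R * n%:R <= 2 * h%:R :> R by rewrite -!natrM ler_nat leq_trunc_div.
(* Here [d m <= d X <= 2 d n <= 4 h <= 2 H], as [X < n + 1 <= 2 n], and [m <= H]. *)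
have dm : (d%:R + 1) * m <= 3 * H.
  have d0 : 0 <= d%:R :> R := ler0n _ _.
  have : d%:R * m <= d%:R * (2 * n%:R).
    by apply: ler_wpM2l => //; rewrite -natr1 in Xn; lra.
  by rewrite mulrDl mul1r; lra.
have pR : 0 < p%:R :> R by rewrite ltr0n prime_gt0.
(* Uses [H / 2 < h + 1], [K / 2 < k + 1] and [p / 2 <= p - 1]. *)
have countR : J%:R * (H / 2 * (K / 2) * (p%:R / 2)) ^+ 2 <= 4 * p%:R ^+ 5 * (d%:R + 1).
  apply: (@le_trans _ _ (J%:R * (h.+1%:R * k.+1%:R * p.-1%:R) ^+ 2)).
    apply: ler_wpM2l; first exact: ler0n.
    have q2 : p%:R / 2 <= p.-1%:R :> R.
      rewrite ler_pdivrMr ?ltr0n // -natrM ler_nat.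
      by move: p2; clear; case: p => [|[|q]] // _; rewrite /= muln2 -addnn addSnnS leq_addl.
    rewrite ler_pXn2r ?nnegrE ?mulr_ge0 ?ler0n ?invr_ge0 ?ler0n //; try exact: ltW.
    by apply: ler_pM; rewrite ?mulr_ge0 ?invr_ge0 ?ler0n //; try exact: ltW;
       apply: ler_pM => //; exact: ltW.
  by move: count; rewrite -(ler_nat R) !(natrM, natrX, natrD).
(* The constant is [64 * 4 * 3]: 64 from the squared halves, 4 from Weil's bound, 3 from [dm]. *)
have : J%:R * (H * K ^+ 2 * m) <= 768%:R * p%:R ^+ 3.
  have HP : 0 < H * p%:R ^+ 2 by rewrite mulr_gt0 // exprn_gt0.
  rewrite -(ler_pM2l HP).
  have -> : H * p%:R ^+ 2 * (J%:R * (H * K ^+ 2 * m)) =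
     64%:R * (m * (J%:R * (H / 2 * (K / 2) * (p%:R / 2)) ^+ 2)) by field.
  have -> : H * p%:R ^+ 2 * (768%:R * p%:R ^+ 3) = 64%:R * (4 * p%:R ^+ 5 * (3 * H)) by ring.
  apply: ler_wpM2l; first exact: ler0n.
  apply: le_trans (ler_wpM2l (ltW m0) countR) _.
  have -> : m * (4 * p%:R ^+ 5 * (d%:R + 1)) = 4 * p%:R ^+ 5 * ((d%:R + 1) * m) by ring.
  apply: ler_wpM2l dm.
  by rewrite mulr_ge0 ?ler0n // exprn_ge0 // ltW.
apply/negP; rewrite -ltNge.
have HKm : 0 < H * K ^+ 2 * m by rewrite !mulr_gt0 // exprn_gt0.
have p3 : 0 < p%:R ^+ 3 :> R by rewrite exprn_gt0.
have lnp : ln 2%:R `^ (3 + eps) <= ln p%:R `^ (3 + eps) :> R.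
  have ln2p : ln 2%:R <= ln p%:R :> R by rewrite ler_ln ?posrE ?ltr0n ?prime_gt0 // ler_nat.
  apply: ge0_ler_powR => //; rewrite ?nnegrE; [lra | exact: ltW | lra].
apply: (@lt_le_trans _ _ (1000%:R * p%:R ^+ 3)); first by rewrite ltr_pM2r // ltr_nat.
move: bigJ; rewrite mulrA ler_pdivrMr //; apply: le_trans.
set l2 := ln 2%:R `^ _ in L2 lnp *; set lp := ln p%:R `^ _ in lnp *.
have -> : 1000%:R / l2 * (p%:R ^+ 3 * lp) = 1000%:R * p%:R ^+ 3 * (lp / l2) by ring.
rewrite ler_peMr ?mulr_ge0 ?ler0n ?(ltW p3) //.
by rewrite ler_pdivlMr // mul1r.
Qed.
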